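(* Let $\mathcal{A}$ be an integral affinographic hyperplane arrangement in $\mathbb{R}^n$ and let $m\in\mathbb Z$ be nonnegative. The number of integer points in $[m]^n$ that are contained in none of the hyperplanes of $\mathcal{A}$ equals $\chi^{\mathbb Z}_{\Phi(\mathcal A)}(m)$, the number of proper integral $m$-colorations of the integral gain graph $\Phi=\Phi(\mathcal A)$, and hence equals $$\sum_{B\in\operatorname{Lat}^{\mathrm b}\Phi}\mu(\varnothing,B)\prod_{W\in\pi(B)}\big[m-h_B(W)\big]^+ ,$$ where $\mu$ is the M\''obius function of $\operatorname{Lat}^{\mathrm b}\Phi$.
   Context: An integral affinographic hyperplane arrangement in $\mathbb R^n$ is a finite set $\mathcal A$ of affine hyperplanes of the form $h_{ij}(g): x_j-x_i=g$ with $i,j\in[n]$, $i\neq j$, $g\in\mathbb Z$. Here $[m]=\{1,\dots,m\}$, $[0]=\varnothing$. An integral gain graph consists of a graph $(V,E)$ (loops and multiple edges allowed) and a gain function $\varphi$ assigning an integer to each oriented edge, with $\varphi(e^{-1})=-\varphi(e)$ when $e^{-1}$ is $e$ with the opposite orientation. The notation $g e_{ij}$ means an edge with endpoints $v_i,v_j$ whose gain in the direction from $v_i$ to $v_j$ is $g$. The integral gain graph $\Phi(\mathcal A)$ has vertex set $V=\{v_1,\dots,v_n\}$ and one edge $g e_{ij}$ for each hyperplane $h_{ij}(g)\in\mathcal A$ (the hyperplanes $h_{ij}(g)$ and $h_{ji}(-g)$ coincide and give the same edge). An integral $m$-coloration is a function $x:V\to[m]$, $v_i\mapsto x_i$; it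 is proper if $x_j\ne x_i+g$ for every edge $g e_{ij}$. The gain of a path or circle is the sum of the gains of its edges, all oriented in the direction of traversal. A circle is a connected subgraph that is regular of degree 2, or its edge set. An edge set is balanced if every circle contained in it has gain $0$. A balanced edge set $B$ is closed if it contains every edge $g e_{ij}$ of $\Phi$ such that $B$ contains a path from $v_i$ to $v_j$ with gain $g$. $\operatorname{Lat}^{\mathrm b}\Phi$ is the set of all closed, balanced edge sets, ordered by inclusion. For a balanced set $B$, $\pi(B)$ is the partition of $V$ into the vertex sets of the connected components of $(V,B)$. For $W\in\pi(B)$, the height $h_B(W)$ is the maximum gain of a path (in either direction, length $0$ with gain $0$ allowed) in the component of $(V,B)$ with vertex set $W$. For real $r$, $r^+=\max(r,0)$. *)

(* Defs.v *)
From HB Require Import structures.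
(* The finset notations must shadow the classical ones, hence the order. *)
From mathcomp Require Import boolp classical_sets functions cardinality reals.
From mathcomp Require Import finmap.
From mathcomp Require Import all_boot all_order all_algebra.

Set Implicit Arguments.
Unset Strict Implicit.
Unset Printing Implicit Defensive.

Import Order.TTheory GRing.Theory Num.Theory.
Local Open Scope ring_scope.

(* Loops and multiple edges are allowed.  Each edge carries a reference
   orientation from [src] to [tgt], in which its gain is [gain]. *)
Record gain_graph := GainGraph {
  vert : finType;
  edge : finType;
  src : edge -> vert;
  tgt : edge -> vert;
  gain : edge -> int }.

Section GainGraph.
Variable Phi : gain_graph.
Implicit Types (B C : {set edge Phi}) (u v w : vert Phi).

(* Oriented edges: [(e, true)] is [e] with its reference orientation and
   [(e, false)] is its inverse.  A loop has two orientations. *)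
Definition dart : finType := (edge Phi * bool)%type.

Definition dsrc (d : dart) : vert Phi := if d.2 then src d.1 else tgt d.1.
Definition dtgt (d : dart) : vert Phi := if d.2 then tgt d.1 else src d.1.
Definition dgain (d : dart) : int := if d.2 then gain d.1 else - gain d.1.

Fixpoint walk u (p : seq dart) w : bool :=
  if p is d :: p' then (dsrc d == u) && walk (dtgt d) p' w else u == w.

Definition walk_gain (p : seq dart) : int := \sum_(d <- p) dgain d.

Definition edges_in B (p : seq dart) : bool := all (fun d => d.1 \in B) p.

(* Paths do not repeat vertices; [[::]] is the path of length 0 at [u]. *)
Definition gpath B u (p : seq dart) w : bool :=
  [&& walk u p w, uniq (u :: map dtgt p) & edges_in B p].

Definition adjacent B : rel (vert Phi) :=
  fun u v => [exists d : dart, [&& d.1 \in B, dsrc d == u & dtgt d == v]].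

(* A loop in [C] contributes 2 to the degree. *)
Definition degree C v : nat := #|[set d : dart | (d.1 \in C) && (dsrc d == v)]|.

Definition circle C : Prop :=
  [/\ C != set0,
      (forall v, degree C v = 0%N \/ degree C v = 2%N)
    & (forall u v, (0 < degree C u)%N -> (0 < degree C v)%N ->
         connect (adjacent C) u v)].

(* [p] goes once around the circle [C], in one of the two directions and from
   an arbitrary starting vertex. *)
Definition traversal C (p : seq dart) : Prop :=
  [/\ (exists u, walk u p u), uniq (map fst p)
    & forall e, (e \in C) = (e \in map fst p)].

Definition balanced B : Prop :=
  forall C, C \subset B -> circle C ->
  forall p, traversal C p -> walk_gain p = 0.

Definition gain_closed B : Prop :=
  forall (d : dart) (p : seq dart),
    gpath B (dsrc d) p (dtgt d) -> walk_gain p = dgain d -> d.1 \in B.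

Definition Latb : {set {set edge Phi}} :=
  [set B | `[< balanced B /\ gain_closed B >]].

Definition components B : {set {set vert Phi}} :=
  equivalence_partition (connect (adjacent B)) [set: vert Phi].

(* A path has fewer than [#|V|] edges, and a path of edges of [B] starting in a
   component [W] stays in [W].  The default value 0 of the maximum is the gain
   of a path of length 0. *)
Definition height B (W : {set vert Phi}) : int :=
  \big[Num.max/0]_(k < #|vert Phi|)
    \big[Num.max/0]_(p : k.-tuple dart |
        [exists u in W, exists w in W, gpath B u p w]) walk_gain p.

(* The ordinal [c < m] stands for the colour [c + 1] of [[m] = {1, ..., m}]. *)
Definition color (m : nat) (c : 'I_m) : int := c.+1%:Z.

Definition proper_coloration (m : nat) (x : {ffun vert Phi -> 'I_m}) : bool :=
  [forall d : dart, color (x (dtgt d)) != color (x (dsrc d)) + dgain d].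

Definition chiZ (m : nat) : nat :=
  #|[set x : {ffun vert Phi -> 'I_m} | proper_coloration x]|.

End GainGraph.

Section Moebius.
Variables (T : finType) (L : {set {set T}}).
Implicit Types A B C : {set T}.

(* [k] is fuel: [#|B|] suffices, as cardinals decrease along recursive calls. *)
Fixpoint moebius_rec (k : nat) A B : int :=
  if A == B then 1 else
  if k is k'.+1 then
    if A \proper B then
      - \sum_(C in L | (A \subset C) && (C \proper B)) moebius_rec k' A C
    else 0
  else 0.

Definition moebius A B : int := moebius_rec #|B| A B.

Lemma moebius_rec_fuel j k A B :
  (#|B| <= j)%N -> (#|B| <= k)%N -> moebius_rec j A B = moebius_rec k A B.
Proof.
have card0F C : (#|C| <= 0)%N -> (A \proper C) = false.
  by move=> C0; apply/negP => /proper_card; rewrite ltnNge (leq_trans C0).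
elim: j k B => [|j IH] [|k] B hj hk //=; case: eqP => // _.
- by rewrite card0F.
- by rewrite card0F.
case: ifP => // _; congr (- _); apply: eq_bigr => C /andP[_ /andP[_ CB]].
have hC := proper_card CB.
by apply: IH; rewrite -ltnS; apply: leq_trans hC _.
Qed.

Lemma moebius_refl A : moebius A A = 1.
Proof. by rewrite /moebius; case: #|A| => [|k] /=; rewrite eqxx. Qed.

Lemma moebius_sum A B : B \in L -> A \proper B ->
  \sum_(C in L | (A \subset C) && (C \subset B)) moebius A C = 0.
Proof.
move=> LB AB; rewrite (bigD1 B) /=; last by rewrite LB subxx proper_sub.
suff -> : moebius A B =
    - \sum_(C in L | (A \subset C) && (C \proper B)) moebius A C.
  rewrite addrC; apply/eqP; rewrite subr_eq0; apply/eqP; apply: eq_bigl => C.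
  by rewrite -!andbA properEneq [(C != B) && _]andbC.
rewrite {1}/moebius; move: (proper_card AB).
case E: #|B| => [//|k] _ /=; rewrite AB.
case: eqP AB => [->|_ AB]; first by rewrite properxx.
congr (- _); apply: eq_bigr => C /andP[_ /andP[_ CB]].
by apply: moebius_rec_fuel => //; rewrite -ltnS -E proper_card.
Qed.

End Moebius.

Definition hyperplane (R : realType) (n : nat) (i j : 'I_n) (g : int) :
    set 'rV[R]_n :=
  fun x => x ord0 j - x ord0 i = g%:~R.

Record affinographic (R : realType) (n : nat) := Affinographic {
  hyperplanes :> {fset (set 'rV[R]_n)};
  hyperplanesP : forall H, H \in hyperplanes ->
    exists t : 'I_n * 'I_n * int,
      t.1.1 != t.1.2 /\ H = hyperplane t.1.1 t.1.2 t.2 }.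

Section Arrangement.
Variables (R : realType) (n : nat) (A : affinographic R n).

(* [(i, j, g)] with [H = hyperplane i j g]; such a triple is unique up to
   exchange with [(j, i, - g)], so the choice only fixes a reference
   orientation of the edge. *)
Definition hyperplane_data (H : hyperplanes A) : 'I_n * 'I_n * int :=
  projT1 (cid (hyperplanesP (valP H))).

Definition Phi_of : gain_graph :=
  @GainGraph 'I_n (hyperplanes A)
    (fun H => (hyperplane_data H).1.1)
    (fun H => (hyperplane_data H).1.2)
    (fun H => (hyperplane_data H).2).

Definition integer_points_off (m : nat) : set 'rV[R]_n :=
  fun x => (forall i, exists k : nat, (1 <= k <= m)%N /\ x ord0 i = k%:R) /\
           (forall H, H \in hyperplanes A -> ~ H x).

End Arrangement.

(* Main.v *)
(** The improper edges of a coloration [x] form a closed balanced set, because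
    [x] itself is a potential for their gains.  Moebius inversion over
    [Latb Phi] therefore reduces the claim to counting the colorations that are
    improper on all edges of a given balanced [B].  A balanced [B] has a
    potential, since a closed walk breaks up into trips around circles and
    backtracked edges.  On a component [W] such a coloration is a translate of
    the potential, whose range there is [height B W], so that [m - height B W]
    translates, or none, fit into [[m]]. *)
Require Import Defs.
From mathcomp Require Import boolp classical_sets functions cardinality reals.
From mathcomp Require Import finmap.
From mathcomp Require Import all_boot all_order all_algebra.
From mathcomp Require Import zify.

Import Order.TTheory GRing.Theory Num.Theory.
Local Open Scope ring_scope.

Lemma not_uniq_map (T U : eqType) (f : T -> U) (s : seq T) :
  ~~ uniq (map f s) ->
  exists s1 x s2 y s3, s = s1 ++ x :: s2 ++ y :: s3 /\ f x = f y.
Proof.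
elim: s => [//|x s IH] /=; case: (boolP (f x \in map f s)) => [/mapP[y ys fxy] _|_ /= nu].
  case/splitPr: ys => s2 s3.
  by exists [::], x, s2, y, s3.
by have [s1 [y [s2 [z [s3 [-> fyz]]]]]] := IH nu; exists (x :: s1), y, s2, z, s3.
Qed.

Section Walks.
Variable Phi : gain_graph.
Implicit Types (B C : {set edge Phi}) (u v w : vert Phi) (d : dart Phi).
Implicit Types (p q : seq (dart Phi)).

Definition reverse d : dart Phi := (d.1, ~~ d.2).

Lemma dsrc_reverse d : dsrc (reverse d) = dtgt d.
Proof. by rewrite /dsrc /dtgt /=; case: d.2. Qed.

Lemma dtgt_reverse d : dtgt (reverse d) = dsrc d.
Proof. by rewrite /dsrc /dtgt /=; case: d.2. Qed.

Lemma dgain_reverse d : dgain (reverse d) = - dgain d.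
Proof. by rewrite /dgain /=; case: d.2; rewrite ?opprK. Qed.

Lemma dart_eq_or_reverse d d' : d.1 = d'.1 -> d' = d \/ d' = reverse d.
Proof.
by case: d d' => [e []] [e' []] /= <-; rewrite /reverse /=; [left|right|right|left].
Qed.

Lemma walk_last u p w : walk u p w -> w = last u (map (@dtgt Phi) p).
Proof. by elim: p u => [u /eqP|d p IH u /= /andP[_ /IH]]. Qed.

Lemma walk_cat u p q w :
  walk u (p ++ q) w =
  walk u p (last u (map (@dtgt Phi) p)) && walk (last u (map (@dtgt Phi) p)) q w.
Proof.
by elim: p u => [u|d p IH u] /=; rewrite ?eqxx // IH andbA.
Qed.

Lemma walk_gain_nil : @walk_gain Phi [::] = 0.
Proof. exact: big_nil. Qed.

Lemma walk_gain_cons d p : walk_gain (d :: p) = dgain d + walk_gain p.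
Proof. exact: big_cons. Qed.

Lemma walk_gain_cat p q : walk_gain (p ++ q) = walk_gain p + walk_gain q.
Proof. exact: big_cat. Qed.

Definition potential B (t : vert Phi -> int) : Prop :=
  forall d, d.1 \in B -> t (dtgt d) = t (dsrc d) + dgain d.

Lemma potential_walk B t u p w :
  potential B t -> edges_in B p -> walk u p w -> walk_gain p = t w - t u.
Proof.
move=> tP; elim: p u => [u _ /eqP->|d p IH u /=]; first by rewrite walk_gain_nil subrr.
case/andP=> dB pB /andP[/eqP <- /(IH _ pB) e].
by rewrite walk_gain_cons e tP //; lia.
Qed.

Lemma adjacentP B u v :
  reflect (exists d, [/\ d.1 \in B, dsrc d = u & dtgt d = v]) (adjacent B u v).
Proof.
apply: (iffP existsP) => -[d]; first by case/and3P => ? /eqP ? /eqP ?; exists d.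
by case=> dB <- <-; exists d; rewrite dB !eqxx.
Qed.

Lemma connect_adjacent_sym B : connect_sym (adjacent B).
Proof.
apply: sym_connect_sym; apply: symmetric_from_pre => u v /adjacentP[d [dB du dv]].
by apply/adjacentP; exists (reverse d); rewrite dsrc_reverse dtgt_reverse.
Qed.

Lemma walk_connect B u p w :
  edges_in B p -> walk u p w -> connect (adjacent B) u w.
Proof.
elim: p u => [u _ /eqP-> //|d p IH u /= /andP[dB pB] /andP[/eqP du pw]].
by apply: connect_trans (IH _ pB pw); apply/connect1/adjacentP; exists d.
Qed.

Lemma connect_gpath B u w :
  connect (adjacent B) u w -> exists p, gpath B u p w.
Proof.
case/connectP=> s /shortenP[s' us' un _ ->] {s}.
suff [p [pw pB ps]] : exists p, [/\ walk u p (last u s'), edges_in B p & map (@dtgt Phi) p = s'].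
  by exists p; rewrite /gpath pw pB ps andbT.
elim: s' u us' {un} => [u _|v s IH u /= /andP[/adjacentP[d [dB du dv]] /IH]].
  by exists [::]; rewrite /= eqxx.
by case=> p [pw pB ps]; exists (d :: p); rewrite /= du dB dv ps eqxx.
Qed.

Lemma closed_walk_vertices u p :
  walk u p u -> perm_eq (map (@dsrc Phi) p) (map (@dtgt Phi) p).
Proof.
have src_tgt w v : walk w p v ->
    rcons (map (@dsrc Phi) p) v = w :: map (@dtgt Phi) p.
  elim: p w => [w /eqP->//|d p IH w /= /andP[/eqP-> /IH->]] //.
move/src_tgt => e; have : perm_eq (rcons (map (@dsrc Phi) p) u) (u :: map (@dtgt Phi) p).
  by rewrite e.
by rewrite perm_rcons perm_cons.
Qed.

Lemma circle_of_closed_walk u p (C := [set e in map fst p]) :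
  p != [::] -> walk u p u -> uniq (map (@dtgt Phi) p) -> uniq (map fst p) ->
  circle C /\ traversal C p.
Proof.
move=> p0 pu vU eU.
have CE e : (e \in C) = (e \in map fst p) by rewrite inE.
have pC : edges_in C p.
  by apply/allP => d dp; rewrite CE map_f.
have degE v : degree C v = (2 * (v \in map (@dtgt Phi) p))%N.
  have dU : uniq (p ++ map reverse p).
    rewrite cat_uniq (map_uniq eU) /=; apply/andP; split.
      apply/hasPn => d' /mapP[d dp ->]; apply/negP => rp.
      have := nth_index d dp; have := nth_index d rp.
      have ii : index (reverse d) p = index d p.
        apply/eqP; rewrite -(nth_uniq d.1 _ _ eU) ?size_map ?index_mem //.
        by rewrite !(nth_map d) ?index_mem // !nth_index.
      by rewrite ii => -> /(congr1 snd) /=; case: d.2.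
    rewrite map_inj_uniq ?(map_uniq eU) //.
    by move=> [e b] [e' b'] [-> /negb_inj->].
  have -> : degree C v = count (fun d => dsrc d == v) (p ++ map reverse p).
    rewrite -size_filter -(card_uniqP (filter_uniq _ dU)).
    apply: eq_card => d; rewrite inE mem_filter andbC; congr (_ && _).
    rewrite CE mem_cat; apply/mapP/orP => [[d' d'p e]|[dp|/mapP[d' d'p ->]]].
    - case: (dart_eq_or_reverse d' d (esym e)) => ->; [by left|right].
      exact: map_f.
    - by exists d.
    - by exists d'.
  rewrite count_cat.
  have -> : count (fun d => dsrc d == v) p = count_mem v (map (@dsrc Phi) p).
    by rewrite count_map.
  have -> : count (fun d => dsrc d == v) (map reverse p) =
      count_mem v (map (@dtgt Phi) p).
    by rewrite !count_map; apply: eq_count => d /=; rewrite dsrc_reverse.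
  by rewrite (permP (closed_walk_vertices _ _ pu)) count_uniq_mem // mul2n addnn.
have conn v : (0 < degree C v)%N -> connect (adjacent C) u v.
  rewrite degE; case: (boolP (v \in _)) => // /mapP[d dp ->] _.
  have [p1 [p2 pE]] : exists p1 p2, p = rcons p1 d ++ p2.
    by case/splitPr: dp => p1 p2; exists p1, p2; rewrite cat_rcons.
  move: pu pC; rewrite pE walk_cat /edges_in all_cat => /andP[w1 _] /andP[e1 _].
  by move: w1; rewrite map_rcons last_rcons => /(walk_connect _ _ _ _ e1).
split; split=> //.
- by case: p p0 @C CE {pu vU eU pC degE conn} => // d p _ C CE; apply/set0Pn; exists d.1; rewrite CE mem_head.
- by move=> v; rewrite degE; case: (_ \in _); [right|left].
- move=> v w /conn uv /conn uw; apply: connect_trans uw.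
  by rewrite connect_adjacent_sym.
- by exists u.
Qed.

(* A closed walk that is not a single trip around a circle splits off a shorter
   closed walk, at a repeated vertex or between the two passages through an edge
   traversed in both directions. *)
Lemma balanced_closed_walk B u p :
  balanced B -> edges_in B p -> walk u p u -> walk_gain p = 0.
Proof.
move=> balB; have [k] := ubnP (size p); elim: k u p => // k IH u p /ltnSE pk pB pu.
have lt_p1p3 (a b c : nat) : (a + (b + c.+1).+1 <= k)%N -> (a + c < k)%N by lia.
have lt_p1dp3 (a b c : nat) : (a + (b + c.+1).+1 <= k)%N -> (a + c.+1 < k)%N.
  by lia.
have lt_p2 (a b c : nat) : (a + (b + c.+1).+1 <= k)%N -> (b < k)%N by lia.
have lt_p2d (a b c : nat) : (a + (b + c.+1).+1 <= k)%N -> (b + 1 < k)%N by lia.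
have [vU|] := boolP (uniq (map (@dtgt Phi) p)); last first.
  case/(@not_uniq_map (dart Phi)) => p1 [d [p2 [d' [p3 [pE dd']]]]].
  move: pk pB pu; rewrite pE /edges_in !(size_cat, all_cat, walk_cat) /=.
  rewrite !(size_cat, all_cat, walk_cat) /= -dd' => pk.
  case/and5P=> p1B dB p2B d'B p3B /and3P[w1 sd /and3P[w2 sd' w3]].
  have c1 : walk_gain (p1 ++ d :: p3) = 0.
    apply: (IH u); rewrite /edges_in ?size_cat ?all_cat ?walk_cat /=.
    - exact: lt_p1dp3 pk.
    - by rewrite p1B dB.
    - by rewrite w1 sd.
  have c2 : walk_gain (rcons p2 d') = 0.
    apply: (IH (dtgt d)); rewrite -?cats1 /edges_in ?size_cat ?all_cat ?walk_cat /=.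
    - exact: lt_p2d pk.
    - by rewrite p2B d'B.
    - by rewrite w2 sd' dd' eqxx.
  move: c1 c2; rewrite -cats1 !(walk_gain_cat, walk_gain_cons) walk_gain_nil; clear; lia.
have [eU|] := boolP (uniq (map fst p)); last first.
  case/(@not_uniq_map (dart Phi)) => p1 [d [p2 [d' [p3 [pE dd']]]]].
  case: (dart_eq_or_reverse d d' dd') => d'E; last first.
    move: pk pB pu; rewrite pE d'E /edges_in !(size_cat, all_cat, walk_cat) /=.
    rewrite !(size_cat, all_cat, walk_cat) /= => pk.
    rewrite dtgt_reverse dsrc_reverse.
    case/and5P=> p1B dB p2B d'B p3B /and3P[w1 /eqP sd /and3P[w2 /eqP sd' w3]].
    have c1 : walk_gain (p1 ++ p3) = 0.
      apply: (IH u); rewrite /edges_in ?size_cat ?all_cat ?walk_cat /=.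
      - exact: lt_p1p3 pk.
      - by rewrite p1B.
      - by rewrite w1 -sd.
    have c2 : walk_gain p2 = 0.
      apply: (IH (dtgt d)) => //; last by rewrite -sd' in w2.
      exact: lt_p2 pk.
    move: c1 c2; rewrite !(walk_gain_cat, walk_gain_cons) dgain_reverse; clear; lia.
  move: vU; rewrite pE d'E !(map_cat, cat_uniq, map_cons) /=.
  by rewrite mem_cat mem_head orbT !andbF.
have [->|p0] := eqVneq p [::]; first exact: walk_gain_nil.
have [cC tC] := circle_of_closed_walk _ _ p0 pu vU eU.
apply: balB cC _ tC; apply/subsetP => e; rewrite inE => /mapP[d dp ->].
exact: (allP pB).
Qed.

Lemma walk_reverse u p w :
  walk u p w -> walk w (rev (map reverse p)) u.
Proof.
elim: p u => [u /=|d p IH u /= /andP[/eqP <- /IH wp]]; first by rewrite eq_sym.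
rewrite rev_cons -cats1 walk_cat -(walk_last _ _ _ wp) wp /=.
by rewrite dsrc_reverse dtgt_reverse !eqxx.
Qed.

Lemma edges_in_reverse B p : edges_in B (rev (map reverse p)) = edges_in B p.
Proof. by rewrite /edges_in all_rev all_map; apply: eq_all. Qed.

Lemma walk_gain_reverse p : walk_gain (rev (map reverse p)) = - walk_gain p.
Proof.
elim: p => [|d p IH]; first by rewrite walk_gain_nil oppr0.
rewrite /= rev_cons -cats1 walk_gain_cat IH !walk_gain_cons walk_gain_nil.
rewrite dgain_reverse; lia.
Qed.

Lemma balanced_potential B : balanced B -> exists t, potential B t.
Proof.
move=> balB; pose r v := fingraph.root (adjacent B) v.
have /choice[P PP] v : exists p, edges_in B p && walk (r v) p v.
  have [|p /and3P[pw _ pB]] := connect_gpath B (r v) v; last by exists p; rewrite pB.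
  by rewrite connect_adjacent_sym connect_root.
exists (fun v => walk_gain (P v)) => d dB.
have rE : r (dtgt d) = r (dsrc d).
  apply/eqP; rewrite (root_connect (connect_adjacent_sym B)) connect_adjacent_sym.
  by apply/connect1/adjacentP; exists d.
have /andP[B1 w1] := PP (dsrc d); have /andP[B2 w2] := PP (dtgt d).
have := balanced_closed_walk B (r (dsrc d)) (P (dsrc d) ++ d :: rev (map reverse (P (dtgt d)))) balB.
rewrite /edges_in all_cat /= -/(edges_in _ _) -/(edges_in _ _) edges_in_reverse B1 B2 dB.
rewrite walk_cat -(walk_last _ _ _ w1) w1 /= eqxx -rE walk_reverse //.
rewrite walk_gain_cat walk_gain_cons walk_gain_reverse => /(_ isT isT); lia.
Qed.

End Walks.

Lemma exists_min (T : finType) (A : {set T}) (f : T -> int) x :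
  x \in A -> exists2 u, u \in A & forall v, v \in A -> f u <= f v.
Proof. by move=> xA; case: (arg_minP f xA) => u uA uP; exists u. Qed.

Section Components.
Variables (Phi : gain_graph) (B : {set edge Phi}).
Implicit Types (u v w : vert Phi) (W : {set vert Phi}).

Lemma connect_adjacent_equivalence :
  {in [set: vert Phi] & &, equivalence_rel (connect (adjacent B))}.
Proof.
move=> u v w _ _ _; split=> // uv; apply/idP/idP; last exact: connect_trans.
by apply: connect_trans; rewrite connect_adjacent_sym.
Qed.

Lemma components_partition : partition (components B) [set: vert Phi].
Proof. exact: equivalence_partitionP connect_adjacent_equivalence. Qed.

Definition component v : {set vert Phi} := pblock (components B) v.

Lemma mem_component v w : (w \in component v) = connect (adjacent B) v w.
Proof.
by rewrite pblock_equivalence_partition ?inE //; exact: connect_adjacent_equivalence.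
Qed.

Lemma component_in v : component v \in components B.
Proof.
by apply: pblock_mem; rewrite (cover_partition components_partition) inE.
Qed.

Lemma component_eq W v : W \in components B -> v \in W -> component v = W.
Proof.
have /and3P[_ tI _] := components_partition; exact: def_pblock tI.
Qed.

Lemma component_inhabited W : W \in components B -> exists v, v \in W.
Proof.
have /and3P[_ _ n0] := components_partition.
by move=> WB; apply/set0Pn; apply: contraNneq n0 => <-.
Qed.

Lemma eq_component u v : connect (adjacent B) u v -> component u = component v.
Proof.
by rewrite -mem_component => /component_eq -> //; apply: component_in.
Qed.

Lemma potential_connect s t u v :
  potential Phi B s -> potential Phi B t -> connect (adjacent B) u v ->
  s v - s u = t v - t u.
Proof.
move=> sP tP /connect_gpath[p /and3P[pw _ pB]].
by rewrite -(potential_walk _ _ _ _ _ _ sP pB pw) (potential_walk _ _ _ _ _ _ tP pB pw).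
Qed.

Lemma gain_le_height W u p w :
  u \in W -> w \in W -> gpath B u p w -> walk_gain p <= height B W.
Proof.
move=> uW wW pP.
have pV : (size p < #|vert Phi|)%N.
  case/and3P: pP => _ un _; have := card_uniqP un; rewrite /= size_map => <-.
  exact: max_card.
pose k := Ordinal pV; pose q : k.-tuple (dart Phi) := in_tuple p.
rewrite /height; apply: le_trans (le_bigmax _ _ k) => /=.
apply: (@le_bigmax_cond _ int _ 0 q _ (fun r : k.-tuple (dart Phi) => walk_gain r)).
by apply/existsP; exists u; rewrite uW; apply/existsP; exists w; rewrite wW.
Qed.

Lemma height_le W (c : int) : 0 <= c ->
  (forall u p w, u \in W -> w \in W -> gpath B u p w -> walk_gain p <= c) ->
  height B W <= c.
Proof.
move=> c0 H; rewrite /height; apply/bigmax_leP; split=> // k _.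
apply/bigmax_leP; split=> // p /existsP[u /andP[uW /existsP[w /andP[wW pP]]]].
exact: H uW wW pP.
Qed.

Lemma height_potential (t : vert Phi -> int) W u w :
  potential Phi B t -> W \in components B -> u \in W -> w \in W ->
  (forall v, v \in W -> t u <= t v <= t w) -> height B W = t w - t u.
Proof.
move=> tP WB uW wW tuw; apply/eqP; rewrite eq_le; apply/andP; split.
  apply: height_le => [|u' p w' u'W w'W /and3P[pw _ pB]].
    by have := tuw _ uW; lia.
  rewrite (potential_walk _ _ _ _ _ _ tP pB pw).
  by have := tuw _ u'W; have := tuw _ w'W; lia.
have [|p pP] := connect_gpath _ B u w; first by rewrite -mem_component (component_eq W).
have := gain_le_height _ _ _ _ uW wW pP.
by case/and3P: pP => pw _ pB; rewrite (potential_walk _ _ _ _ _ _ tP pB pw).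
Qed.

Lemma balanced_normalized_potential : balanced B ->
  exists t : vert Phi -> nat, [/\ potential Phi B (fun v => (t v)%:Z),
    forall W v, W \in components B -> v \in W -> (t v)%:Z <= height B W,
    forall W, W \in components B -> exists2 u, u \in W & t u = 0%N &
    forall W, W \in components B -> exists2 w, w \in W & (t w)%:Z = height B W].
Proof.
case/balanced_potential=> s sP.
have /choice[lo loP] W : exists c, W \in components B ->
    exists2 u, u \in W & s u = c /\ forall v, v \in W -> c <= s v.
  have [/component_inhabited[v vW]|_] := boolP (W \in components B); last by exists 0.
  by have [u uW uP] := exists_min _ W s v vW; exists (s u) => _; exists u.
have /choice[hi hiP] W : exists c, W \in components B ->
    exists2 u, u \in W & s u = c /\ forall v, v \in W -> s v <= c.
  have [/component_inhabited[v vW]|_] := boolP (W \in components B); last by exists 0.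
  have [u uW uP] := exists_min _ W (fun v => - s v) v vW.
  by exists (s u) => _; exists u => //; split=> // w /uP; rewrite lerN2.
have tE v : (`|s v - lo (component v)|%N)%:Z = s v - lo (component v).
  have [_ _ [_ lov]] := loP _ (component_in v).
  by have := lov v; rewrite mem_component connect0 => /(_ isT); lia.
have hE W : W \in components B -> height B W = hi W - lo W.
  move=> WB; have [l lW [le loW]] := loP _ WB; have [h hW [he hiW]] := hiP _ WB.
  by rewrite -he -le; apply: height_potential => // v vW; rewrite he le loW ?hiW.
exists (fun v => `|s v - lo (component v)|%N); split.
- move=> d dB; rewrite !tE sP //.
  rewrite (eq_component (dsrc d) (dtgt d)); first by lia.
  by apply/connect1/adjacentP; exists d.
- move=> W v WB vW; rewrite tE (component_eq W) // hE //.
  by have [_ _ [_ /(_ _ vW)]] := hiP _ WB; lia.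
- move=> W WB; have [l lW [le _]] := loP _ WB; exists l => //.
  by rewrite (component_eq W) // le subrr.
- move=> W WB; have [h hW [he _]] := hiP _ WB; exists h => //.
  by rewrite tE (component_eq W) // hE // he.
Qed.

End Components.

Lemma card_ord_shift m h : #|[pred a : 'I_m.+1 | (a + h < m)%N]| = (m - h)%N.
Proof.
have le_m : (m - h <= m.+1)%N by lia.
rewrite -sum1_card -[RHS]card_ord -sum1_card.
rewrite -(big_ord_narrow (F := fun=> 1%N) le_m).
by apply: eq_bigl => a /=; rewrite inE; lia.
Qed.

Section Colorations.
Variables (Phi : gain_graph) (m : nat).
Implicit Types (B : {set edge Phi}) (x : {ffun vert Phi -> 'I_m}).

Definition improper x : {set edge Phi} :=
  [set e | color (x (tgt e)) == color (x (src e)) + gain e].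

Lemma improperE x (d : dart Phi) :
  (d.1 \in improper x) = (color (x (dtgt d)) == color (x (dsrc d)) + dgain d).
Proof.
rewrite inE /dtgt /dsrc /dgain; case: d.2 => //.
by apply/eqP/eqP; lia.
Qed.

Lemma sub_improperP B x :
  reflect (potential Phi B (fun v => color (x v))) (B \subset improper x).
Proof.
apply: (iffP subsetP) => [BX d dB|pot e eB].
  by apply/eqP; rewrite -improperE; apply: BX.
by rewrite inE; apply/eqP; apply: (pot (e, true)).
Qed.

Lemma proper_colorationE x : proper_coloration x = (improper x == set0).
Proof.
apply/forallP/eqP => [px|x0 d]; last by rewrite -improperE x0 inE.
by apply/setP => e; have := px (e, true); rewrite -improperE inE => /negPf ->; rewrite inE.
Qed.

Lemma improper_Latb x : improper x \in Latb Phi.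
Proof.
have pot := elimT (sub_improperP _ x) (subxx _).
rewrite inE; apply/asboolP; split=> [C CX _ p [[u pu] _ CE]|d p].
  rewrite (potential_walk _ _ _ _ _ _ pot _ pu) ?subrr //.
  by apply/allP => d dp; apply: (subsetP CX); rewrite CE map_f.
case/and3P=> pw _ pB; rewrite (potential_walk _ _ _ _ _ _ pot pB pw) => e.
by rewrite improperE -e; apply/eqP; lia.
Qed.

(* Relative to a potential with minimum 0 on each component, a coloration that
   is improper on [B] is determined by one colour per component, namely the
   smallest one. *)
Lemma card_sub_improper B : balanced B ->
  #|[set x | B \subset improper x]|%:Z =
  \prod_(W in components B) Num.max (m%:Z - height B W) 0.
Proof.
case/balanced_normalized_potential=> t [tP t_le t0 t_max].
pose h W := `|height B W|%N.
have hE W : W \in components B -> height B W = (h W)%:Z.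
  by move=> WB; have [w _ e] := t_max W WB; rewrite /h; lia.
pose F W := [pred a : 'I_m.+1 | (a + h W < m)%N].
pose base x : {ffun {set vert Phi} -> 'I_m.+1} := [ffun W : {set vert Phi} =>
  if [pick u in W | (W \in components B) && (t u == 0%N)] is Some u
  then widen_ord (leqnSn m) (x u) else ord0].
have shift x u v : B \subset improper x -> connect (adjacent B) u v ->
    (x v + t u = x u + t v)%N.
  move=> /sub_improperP xP uv.
  have := potential_connect _ _ _ _ _ _ xP tP uv.
  by rewrite /color; lia.
have baseE x v : B \subset improper x ->
    (x v = base x (component Phi B v) + t v :> nat)%N.
  move=> xB; rewrite ffunE; case: pickP => [u /and3P[uv _ /eqP u0] /=|no].
    by rewrite -(shift x u v) // ?u0 ?addn0 // connect_adjacent_sym -mem_component.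
  have [u uW u0] := t0 _ (component_in _ B v).
  by have := no u; rewrite uW component_in u0.
have base_inj : {in [set x | B \subset improper x] &, injective base}.
  move=> x y; rewrite !inE => xB yB e; apply/ffunP => v; apply: val_inj => /=.
  by rewrite !baseE // e.
rewrite -(card_in_imset base_inj).
have imE : base @: [set x | B \subset improper x] =i pfamily ord0 (components B) F.
  move=> c; apply/imsetP/pfamilyP => [[x xB ->]|[supp cF]].
    rewrite inE in xB; split=> [|W WB].
      apply/subsetP => W; rewrite inE ffunE; case: pickP => [u /and3P[] //|_].
      by rewrite eqxx.
    have [w wW wE] := t_max W WB.
    rewrite inE /=; have := baseE x w xB; rewrite (component_eq _ _ _ _ WB wW).
    have -> : h W = t w by apply/eqP; rewrite -eqz_nat -hE // wE.
    by move=> <-.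
  have cm v : (c (component Phi B v) + t v < m)%N.
    have WB := component_in _ B v.
    have := cF _ WB; rewrite inE /=; apply: leq_trans; rewrite ltnS leq_add2l.
    by rewrite -lez_nat -hE // t_le // mem_component connect0.
  pose x : {ffun vert Phi -> 'I_m} := [ffun v => Ordinal (cm v)].
  have xB : B \subset improper x.
    apply/sub_improperP => d dB; rewrite !ffunE /color /=.
    have -> : component Phi B (dtgt d) = component Phi B (dsrc d).
      by apply/esym/eq_component/connect1/adjacentP; exists d.
    by have := tP d dB; rewrite /=; lia.
  exists x; first by rewrite inE.
  apply/ffunP => W; apply: val_inj; have [WB|WB] := boolP (W \in components B).
    have [u uW _] := t0 W WB; have := baseE x u xB.
    by rewrite (component_eq _ _ _ _ WB uW) ffunE /= (component_eq _ _ _ _ WB uW); lia.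
  rewrite ffunE; case: pickP => [u /and3P[_ WB'] |_]; first by rewrite WB' in WB.
  by apply/eqP; apply: contraNT WB => cW; apply: (subsetP supp); rewrite inE.
rewrite (eq_card imE) card_pfamily foldrE big_image /= (big_morph Posz PoszM (erefl 1%:Z)).
apply: eq_bigr => W WB; rewrite card_ord_shift hE //.
by case: (leqP (h W) m) => hm; lia.
Qed.

Lemma chiZ_moebius :
  (chiZ Phi m)%:Z =
    \sum_(B in Latb Phi)
      moebius (Latb Phi) set0 B *
      \prod_(W in components B) Num.max (m%:Z - height B W) 0.
Proof.
transitivity (\sum_x \sum_(B in Latb Phi | (set0 \subset B) && (B \subset improper x))
    moebius (Latb Phi) set0 B).
  rewrite /chiZ cardsE -sum1_card (big_morph Posz PoszD (erefl 0%:Z)) big_mkcond /=.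
  apply: eq_bigr => x _; rewrite [x \in _]proper_colorationE.
  have [x0|x0] := eqVneq (improper x) set0; last first.
    by rewrite moebius_sum ?improper_Latb // properEneq sub0set eq_sym x0.
  rewrite (big_pred1 set0) ?moebius_refl // => B /=.
  rewrite x0 sub0set subset0 /=; case: eqP => [->|_]; last by rewrite andbF.
  by rewrite -x0 improper_Latb.
rewrite (exchange_big_dep (mem (Latb Phi))) /=; last by move=> x B _ /andP[].
apply: eq_bigr => B BL.
have /asboolP[balB _] : `[< balanced B /\ gain_closed B >] by move: BL; rewrite inE.
rewrite -card_sub_improper // cardsE -sum1_card (big_morph Posz PoszD (erefl 0%:Z)).
rewrite mulr_sumr; apply: eq_big => [x|x _]; last by rewrite mulr1.
by rewrite BL sub0set.
Qed.

End Colorations.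

Lemma card_eq_finset (T : finType) (X : {set T}) : ([set` X]%classic #= `I_#|X|)%card.
Proof.
rewrite (card_eqr card_II).
have -> : [set` X]%classic = ((@enum_val T (mem X)) @` classical_sets.setT)%classic.
  apply/seteqP; split=> [x xX|_ [i _ <-]]; last exact: enum_valP.
  by exists (enum_rank_in xX x) => //; rewrite enum_rankK_in.
by apply: inj_card_eq => i j _ _; apply: enum_val_inj.
Qed.

Section Points.
Variables (R : realType) (n : nat) (A : affinographic R n) (m : nat).

Definition coloration_point (x : {ffun 'I_n -> 'I_m}) : 'rV[R]_n :=
  \row_i (x i).+1%:R.

Lemma coloration_point_inj : injective coloration_point.
Proof.
move=> x y /rowP e; apply/ffunP => i; apply: val_inj.
by have := e i; rewrite !mxE => /eqP; rewrite eqr_nat => /eqP[].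
Qed.

Lemma coloration_point_on_hyperplane (x : {ffun 'I_n -> 'I_m}) i j (g : int) :
  hyperplane i j g (coloration_point x) <-> color (x j) = color (x i) + g.
Proof.
rewrite /hyperplane /color !mxE !pmulrn -intrB; split=> [/intr_inj|]; first by lia.
by move=> e; congr (_%:~R); lia.
Qed.

Lemma improper_hyperplaneP (x : {ffun 'I_n -> 'I_m}) (H : hyperplanes A) :
  reflect (val H (coloration_point x)) (H \in improper (Phi_of A) m x).
Proof.
have [_ ->] := projT2 (cid (hyperplanesP (valP H))).
rewrite inE; apply: (iffP eqP) => /coloration_point_on_hyperplane; exact.
Qed.

Lemma proper_colorationP (x : {ffun 'I_n -> 'I_m}) :
  reflect (forall H, H \in hyperplanes A -> ~ H (coloration_point x))
          (@proper_coloration (Phi_of A) m x).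
Proof.
rewrite proper_colorationE; apply: (iffP eqP) => [x0 H HA Hx|off].
  have /improper_hyperplaneP : val [` HA]%fset (coloration_point x) by [].
  by rewrite x0 inE.
apply/setP => H; rewrite in_set0; apply/negP => /improper_hyperplaneP.
exact: off (valP H).
Qed.

Lemma integer_points_offE :
  integer_points_off A m =
  (coloration_point @` [set` [set x | @proper_coloration (Phi_of A) m x]%SET])%classic.
Proof.
apply/seteqP; split=> [p [int_p off_p]|_ [x xP <-]] /=; last first.
  have {xP} : x \in [set x | @proper_coloration (Phi_of A) m x]%SET by [].
  rewrite inE => /proper_colorationP px.
  split=> // i.
  by exists (x i).+1; rewrite mxE /= ltn_ord.
have /choice[c cP] i : exists c : 'I_m, p ord0 i = c.+1%:R.
  by have [[|k] [km pk]] := int_p i; rewrite // in km *; exists (Ordinal km).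
have pE : coloration_point (finfun c) = p.
  by apply/rowP => i; rewrite !mxE ffunE cP.
exists (finfun c) => //=; rewrite inE; apply/proper_colorationP => H HA.
by rewrite pE; apply: off_p.
Qed.

Lemma card_integer_points_off :
  (integer_points_off A m #= `I_(chiZ (Phi_of A) m))%card.
Proof.
rewrite integer_points_offE.
apply: (card_eq_trans (inj_card_eq (in2W coloration_point_inj))).
exact: card_eq_finset.
Qed.

End Points.

Theorem theorem4p1 (R : realType) (n : nat) (A : affinographic R n) (m : nat) :
  (integer_points_off A m #= `I_(chiZ (Phi_of A) m))%card /\
  (chiZ (Phi_of A) m)%:Z =
    \sum_(B in Latb (Phi_of A))
      moebius (Latb (Phi_of A)) set0 B *
      \prod_(W in components B) Num.max (m%:Z - height B W) 0.
Proof.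
by split; [exact: card_integer_points_off|exact: chiZ_moebius].
Qed.
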